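(* Let $\Pi$, $Q$ be probability distributions on $\mathbb{R}^d$ with Lebesgue densities $\pi$, $q$ having support $\Theta$, let $P$ be the Metropolis-Hastings independence kernel with target $\Pi$ and proposal $Q$, let $\rho$ be a lower semicontinuous metric, and let $\mathcal{W}_\rho$ be the associated Wasserstein distance (all as in the context). Suppose there exists a solution $\theta^* = \operatorname{argmin}\{ q(\theta)/\pi(\theta) : \theta \in \Theta\}$, i.e. a point $\theta^* \in \Theta$ at which $q/\pi$ attains its minimum over $\Theta$. Then for every integer $t \ge 1$, $$\mathcal{W}_{\rho}\left( P^t(\theta^*, \cdot), \Pi \right) = \left( 1 - \frac{q(\theta^* )}{\pi(\theta^* )} \right)^t \int \rho(\theta, \theta^* )\, d\Pi(\theta).$$
   Context: Setting: $\Theta \subseteq \mathbb{R}^d$ is a nonempty measurable set. $\Pi$ (target) and $Q$ (proposal) are probability distributions on $\mathbb{R}^d$ with $Q \ne \Pi$, with Lebesgue densities $\pi$ and $q$ respectively, both with support $\Theta$, meaning that $\pi$ and $q$ are strictly positive on $\Theta$ and zero outside $\Theta$. Metropolis-Hastings independence (MHI) kernel: define $a(\theta,\theta') = \min\left\{ \frac{\pi(\theta') q(\theta)}{\pi(\theta) q(\theta')}, 1\right\}$ if $\pi(\theta) q(\theta') > 0$ and $a(\theta,\theta') = 1$ if $\pi(\theta) q(\theta') = 0$. For $\theta \in \mathbb{R}^d$ and measurable $B \subseteq \mathbb{R}^d$, $$P(\theta, B) = \int_B a(\theta,\theta') q(\theta')\, d\theta' + \delta_\theta(B)\left(1 - \int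 a(\theta,\theta') q(\theta')\, d\theta'\right),$$ where $\delta_\theta$ is the Dirac measure at $\theta$; $P^1 = P$ and $P^t(\theta,B) = \int P(\theta, d\theta') P^{t-1}(\theta', B)$ for $t \ge 2$. Wasserstein distance: for a lower semicontinuous metric $\rho$ on $\mathbb{R}^d$ (i.e. a metric that is lower semicontinuous as a function on $\mathbb{R}^d\times\mathbb{R}^d$ with the Euclidean topology) and probability measures $\mu,\nu$, $\mathcal{W}_\rho(\mu,\nu) = \inf_{\xi \in \mathcal{C}(\mu,\nu)} \int \rho(\theta,\omega)\, d\xi(\theta,\omega)$, where $\mathcal{C}(\mu,\nu)$ is the set of joint probability measures with marginals $\mu$ and $\nu$. Values in $[0,+\infty]$ are allowed. *)

(* Defs.v *)
From HB Require Import structures.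
From mathcomp Require Import all_boot all_order all_algebra.
From mathcomp Require Import all_classical all_reals all_analysis.
From mathcomp Require Import measurable_realfun.
Set Implicit Arguments.
Unset Strict Implicit.
Unset Printing Implicit Defensive.
Import Order.TTheory GRing.Theory Num.Theory.
Import numFieldNormedType.Exports.
Local Open Scope classical_set_scope.
Local Open Scope ring_scope.

Section borel_rV.
Context {R : realType}.

(* 'rV[R]_d, with its product topology, carries the Borel sigma-algebra. *)
HB.instance Definition _ (d : nat) :=
  @isMeasurable.Build (sigma_display (@open 'rV[R]_d)) 'rV[R]_d
    <<s @open 'rV[R]_d >> (@sigma_algebra0 _ setT _) (@sigma_algebraC _ _)
    (@sigma_algebra_bigcup _ setT _).

Lemma open_measurable_rV (d : nat) (A : set 'rV[R]_d) : open A -> measurable A.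
Proof. by move=> oA; exact: sub_sigma_algebra. Qed.

Lemma measurable_rV_coord (d : nat) (i : 'I_d) :
  measurable_fun [set: 'rV[R]_d] (fun x : 'rV[R]_d => x ord0 i).
Proof.
apply: (measurability _ (RGenOpens.measurableE R)) => _ [_ [a [b ->]] <-].
rewrite setTI; apply: open_measurable_rV.
apply: open_comp; last exact: interval_open.
by move=> x _; exact: coord_continuous.
Qed.

Lemma ball_rV (d : nat) (c : 'rV[R]_d) (e : R) : 0 < e ->
  ball c e = [set x | forall i : 'I_d, ball (c ord0 i) e (x ord0 i)].
Proof.
move=> e0; apply/seteqP; split=> [x [_ h] i|x h]; first exact: h.
by split => // i j; rewrite (ord1 i).
Qed.

Definition rat_ball (d : nat) (p : 'rV[rat]_d * nat) : set 'rV[R]_d :=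
  ball (\row_i (ratr (p.1 ord0 i) : R) : 'rV[R]_d) p.2.+1%:R^-1.

Lemma rat_ballE (d : nat) (p : 'rV[rat]_d * nat) : rat_ball p =
  [set x | forall i, ball (ratr (p.1 ord0 i) : R) p.2.+1%:R^-1 (x ord0 i)].
Proof.
rewrite /rat_ball ball_rV ?invr_gt0//.
by apply/seteqP; split=> x /= h i; move: (h i); rewrite !mxE.
Qed.

Lemma open_rV_bigcup (d : nat) (U : set 'rV[R]_d) : open U ->
  U = \bigcup_(p : 'rV[rat]_d * nat)
    (if `[< rat_ball p `<=` U >] then rat_ball p else set0).
Proof.
move=> oU; apply/seteqP; split=> [x Ux|x [p _]]; last first.
  by case: ifPn => // /asboolP; exact.
have /nbhs_ballP[e /= e0 xeU] : nbhs x U by exact: open_nbhs_nbhs.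
have [k ke] : exists k : nat, k.+1%:R^-1 + k.+1%:R^-1 < e.
  have e20 : 0 < e / 2 by rewrite divr_gt0.
  have [k _ /(_ k (leqnn k)) h] := near_infty_natSinv_lt (PosNum e20).
  by exists k; rewrite [ltRHS](splitr e); exact: ltrD.
pose r : R := k.+1%:R^-1.
have r0 : 0 < r by rewrite invr_gt0.
have hq i : {q : rat | ball (x ord0 i) r (ratr q)}.
  apply: cid; have xr0 : ball (x ord0 i) r !=set0.
    by exists (x ord0 i); exact: ballxx.
  have [_ [] /[swap] -[q _ <-] xq] := dense_rat xr0 (ball_open _ _).
  by exists q.
pose c : 'rV[rat]_d := \row_i sval (hq i).
have xc : ball x r (\row_i (ratr (c ord0 i) : R) : 'rV[R]_d).
  by rewrite ball_rV// => i; rewrite !mxE; exact: (svalP (hq i)).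
exists (c, k) => //; rewrite asboolT; first exact/ball_sym.
move=> y cy; apply: xeU; apply: (@le_ball _ _ x (r + r)); first exact: ltW.
exact: ball_triangle cy.
Qed.

Lemma measurable_fun_rV (disp : measure_display) (T : measurableType disp)
    (d : nat) (f : T -> 'rV[R]_d) :
  (forall i, measurable_fun [set: T] (fun t => f t ord0 i)) ->
  measurable_fun [set: T] f.
Proof.
move=> mf; apply: (@measurability _ _ _ _ setT f (@open 'rV[R]_d)) => //.
move=> _ [U oU <-]; rewrite setTI (open_rV_bigcup oU) preimage_bigcup.
apply: countable_bigcupT_measurable; first exact: countableP.
move=> p /=; case: ifPn => _; last by rewrite preimage_set0.
rewrite rat_ballE.
rewrite (_ : _ @^-1` _ = \bigcap_(i in [set: 'I_d])
    (fun t => f t ord0 i) @^-1` ball (ratr (p.1 ord0 i) : R) p.2.+1%:R^-1).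
  apply: fin_bigcap_measurable => // i _; rewrite -[X in measurable X]setTI.
  by apply: mf => //; apply: open_measurable; exact: ball_open.
by apply/seteqP; split=> t /= h i; [move=> _|]; exact: h.
Qed.

End borel_rV.

Section lebesgue_rV.
Context {R : realType}.

Definition row_cons (d : nat) (x : measurableTypeR R * 'rV[R]_d) : 'rV[R]_d.+1 :=
  row_mx (x.1 : R)%:M x.2 : 'rV[R]_(1 + d).

Lemma row_cons0 (d : nat) (x : measurableTypeR R * 'rV[R]_d) :
  row_cons x ord0 ord0 = x.1.
Proof.
rewrite -[RHS](_ : row_mx (x.1 : R)%:M x.2 ord0 (lshift d ord0) = _).
  by rewrite /row_cons; congr (_ _ _); exact/val_inj.
by rewrite row_mxEl mxE eqxx.
Qed.

Lemma row_consS (d : nat) (x : measurableTypeR R * 'rV[R]_d) (i : 'I_d) :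
  row_cons x ord0 (lift ord0 i) = x.2 ord0 i.
Proof.
rewrite -[RHS](row_mxEr (x.1 : R)%:M).
by rewrite /row_cons; congr (_ _ _); exact/val_inj.
Qed.

Lemma measurable_row_cons (d : nat) :
  measurable_fun [set: measurableTypeR R * 'rV[R]_d] (@row_cons d).
Proof.
apply: measurable_fun_rV => i; have [j ->|->] := unliftP ord0 i.
  under eq_fun do rewrite row_consS.
  by apply: (measurableT_comp (measurable_rV_coord j)); exact: measurable_snd.
by under eq_fun do rewrite row_cons0; exact: measurable_fst.
Qed.

Section step.
Context (d : nat) (m : {sigma_finite_measure set 'rV[R]_d -> \bar R}).
Local Open Scope ereal_scope.

Definition lebesgue_cons : set 'rV[R]_d.+1 -> \bar R :=
  pushforward (@lebesgue_measure R \x m) (@row_cons d).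

Let lebesgue_cons0 : lebesgue_cons set0 = 0.
Proof. by rewrite /lebesgue_cons /pushforward preimage_set0 measure0. Qed.

Let lebesgue_cons_ge0 A : 0 <= lebesgue_cons A.
Proof. by rewrite /lebesgue_cons /pushforward measure_ge0. Qed.

Let lebesgue_cons_sigma_additive : semi_sigma_additive lebesgue_cons.
Proof.
move=> F mF tF mUF; rewrite /lebesgue_cons /pushforward preimage_bigcup.
have mp A : measurable A -> measurable (@row_cons d @^-1` A).
  by move=> mA; rewrite -[X in measurable X]setTI; exact: measurable_row_cons.
apply: measure_semi_sigma_additive.
- by move=> n; exact: mp.
- apply/trivIsetP => /= i j _ _ ij; rewrite -preimage_setI.
  by move/trivIsetP : tF => /(_ _ _ _ _ ij) ->//; rewrite preimage_set0.
- by rewrite -preimage_bigcup; exact: mp.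
Qed.

HB.instance Definition _ := isMeasure.Build _ _ _ lebesgue_cons
  lebesgue_cons0 lebesgue_cons_ge0 lebesgue_cons_sigma_additive.

Let lebesgue_cons_sigma_finite : sigma_finite setT lebesgue_cons.
Proof.
have /sigma_finiteP[F [FT Fnd Ffin]] := sigma_finiteT (@lebesgue_measure R).
have /sigma_finiteP[G [GT Gnd Gfin]] := sigma_finiteT m.
pose hd (x : 'rV[R]_d.+1) : R := x ord0 ord0.
pose tl (x : 'rV[R]_d.+1) : 'rV[R]_d := \row_i x ord0 (lift ord0 i).
have mhd : measurable_fun setT hd by exact: measurable_rV_coord.
have mtl : measurable_fun setT tl.
  apply: measurable_fun_rV => i; rewrite /tl.
  rewrite (_ : (fun t => _) = (fun x : 'rV[R]_d.+1 => x ord0 (lift ord0 i))).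
    exact: measurable_rV_coord.
  by apply/funext => t; rewrite mxE.
have hdE x : hd (row_cons x) = x.1 by exact: row_cons0.
have tlE x : tl (row_cons x) = x.2.
  by apply/rowP => i; rewrite mxE row_consS.
exists (fun n => (hd @^-1` F n) `&` (tl @^-1` G n)).
  apply/esym; rewrite -subTset => x _.
  have [i _ Fi] : (\bigcup_i F i) (hd x) by rewrite -FT.
  have [j _ Gj] : (\bigcup_i G i) (tl x) by rewrite -GT.
  exists (maxn i j) => //; split.
    by have /subsetPset := Fnd _ _ (leq_maxl i j); exact.
  by have /subsetPset := Gnd _ _ (leq_maxr i j); exact.
move=> n; have [mF Foo] := Ffin n; have [mG Goo] := Gfin n; split.
  by apply: measurableI; rewrite -[X in measurable X]setTI; [exact: mhd|exact: mtl].
rewrite /lebesgue_cons /pushforward (_ : _ @^-1` _ = F n `*` G n); last first.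
  by apply/seteqP; split=> x /=; rewrite hdE tlE.
by rewrite product_measure1E// lte_mul_pinfty// ge0_fin_numE.
Qed.

HB.instance Definition _ := Measure_isSigmaFinite.Build _ _ _ lebesgue_cons
  lebesgue_cons_sigma_finite.

End step.

(* Lebesgue measure as an iterated product measure; lebesgue_rV_prod gives its
   value on measurable rectangles. *)
Fixpoint lebesgue_rV (d : nat) : {sigma_finite_measure set 'rV[R]_d -> \bar R} :=
  match d with
  | 0 => [the sigma_finite_measure _ _ of \d_(0 : 'rV[R]_0)]
  | d'.+1 => [the sigma_finite_measure _ _ of lebesgue_cons (lebesgue_rV d')]
  end.

Lemma lebesgue_rV_prod (d : nat) (A : 'I_d -> set (measurableTypeR R)) :
  (forall i, measurable (A i)) ->
  lebesgue_rV d [set x | forall i, A i (x ord0 i)] =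
  (\prod_(i < d) lebesgue_measure (A i))%E.
Proof.
elim: d A => [|d IH] A mA.
  by rewrite big_ord0 /= diracE mem_set// => -[].
have mS : measurable [set x : 'rV[R]_d | forall i, A (lift ord0 i) (x ord0 i)].
  rewrite (_ : mkset _ = \bigcap_(i in [set: 'I_d])
      (fun x : 'rV[R]_d => x ord0 i) @^-1` A (lift ord0 i)).
    apply: fin_bigcap_measurable => // i _; rewrite -[X in measurable X]setTI.
    by apply: measurable_rV_coord => //; exact: mA.
  by apply/seteqP; split=> x /= h i; [move=> _|]; exact: h.
rewrite big_ord_recl -IH// -product_measure1E//= /lebesgue_cons /pushforward.
congr (_ _); apply/seteqP; split=> [x /= h|x /= [h0 hS] i].
  split; first by rewrite -[x.1]row_cons0; exact: h.
  by move=> i; rewrite -row_consS; exact: h.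
by have [j ->|->] := unliftP ord0 i; rewrite ?row_consS ?row_cons0.
Qed.

End lebesgue_rV.

Section metric.
Context {R : realType} {T : Type}.

(* A metric unrelated to any topology that T may already carry. *)
Record is_metric (rho : T -> T -> R) : Prop := IsMetric {
  is_metric_ge0 : forall x y, 0 <= rho x y ;
  is_metric_eq0 : forall x y, rho x y = 0 <-> x = y ;
  is_metric_sym : forall x y, rho x y = rho y x ;
  is_metric_triangle : forall x y z, rho x z <= rho x y + rho y z }.

End metric.

Section wasserstein.
Context {disp : measure_display} {T : measurableType disp} {R : realType}.
Implicit Types mu nu : set T -> \bar R.
Local Open Scope ereal_scope.

Definition coupling mu nu : set (probability (T * T)%type R) :=
  [set xi | forall A, measurable A ->
     xi (A `*` setT) = mu A /\ xi (setT `*` A) = nu A].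

Definition wasserstein (rho : T -> T -> R) mu nu : \bar R :=
  ereal_inf [set \int[xi]_z (rho z.1 z.2)%:E | xi in coupling mu nu].

End wasserstein.

Section kernel_iter.
Context {disp : measure_display} {T : measurableType disp} {R : realType}.
Local Open Scope ereal_scope.

(* kernel_iter P 0 is the identity kernel. *)
Fixpoint kernel_iter (P : T -> set T -> \bar R) (t : nat) (x : T) (B : set T)
    : \bar R :=
  match t with
  | 0 => \d_x B
  | 1 => P x B
  | t'.+1 => \int[P x]_y kernel_iter P t' y B
  end.

End kernel_iter.

Section mhi.
Context {R : realType} {d : nat}.
Implicit Types (p q : 'rV[R]_d -> R) (x y : 'rV[R]_d).

(* p is a density of mu with respect to Lebesgue measure whose support is
   Theta, in the sense that p is positive exactly on Theta. *)
Record has_density_on (mu : set 'rV[R]_d -> \bar R) p (Theta : set 'rV[R]_d)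
    : Prop := HasDensityOn {
  density_measurable : measurable_fun [set: 'rV[R]_d] p ;
  densityE : forall A, measurable A ->
    mu A = (\int[lebesgue_rV d]_(x in A) (p x)%:E)%E ;
  density_gt0 : forall x, Theta x -> 0 < p x ;
  density_eq0 : forall x, ~ Theta x -> p x = 0 }.

Definition mhi_accept p q x y : R :=
  if 0 < p x * q y then Num.min (p y * q x / (p x * q y)) 1 else 1.

Definition mhi_kernel p q x (B : set 'rV[R]_d) : \bar R :=
  (\int[lebesgue_rV d]_(y in B) (mhi_accept p q x y * q y)%:E +
   \d_x B * (1 - \int[lebesgue_rV d]_y (mhi_accept p q x y * q y)%:E))%E.

End mhi.

(* Main.v *)
Require Import Defs.
From HB Require Import structures.
From mathcomp Require Import all_boot all_order all_algebra.
From mathcomp Require Import all_classical all_reals all_analysis.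
From mathcomp Require Import measurable_realfun ring lra.
Import Order.TTheory GRing.Theory Num.Theory.
Import numFieldNormedType.Exports.
Local Open Scope classical_set_scope.
Local Open Scope ring_scope.

(* Write z for the minimizer and e = q z / p z. As e * p <= q everywhere, the
   density of accepted moves from z is exactly e * p, so the kernel at z is
   e * Pi + (1 - e) * \d_z. Detailed balance makes Pi stationary, hence
   P^t(z, .) = (1 - (1 - e)^t) * Pi + (1 - e)^t * \d_z. For such a mixture, the
   coupling that keeps the Pi part on the diagonal and couples \d_z with Pi
   independently gives the upper bound. The lower bound is Kantorovich duality
   with the test functions min (rho x z) n, which are 1-Lipschitz for rho and
   bounded, followed by monotone convergence; truncating covers the case where
   the integral of rho is infinite. *)

(** On nonnegative reals the inverse is the power with exponent -1, which is measurable and also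
    takes the value 0 at 0. Negative reals follow by oddness. *)
Lemma measurable_inv (R : realType) :
  measurable_fun [set: R] (fun x : R => x^-1).
Proof.
rewrite (_ : (fun x => _) = fun x : R =>
    if 0 <= x then powR x (-1) else - powR (- x) (-1)).
  apply: measurable_fun_ifT; first exact: measurable_fun_ler.
    exact: (measurable_powR (-1)).
  apply: measurableT_comp => //.
  apply: (measurableT_comp (measurable_powR (-1))) => //.
apply/funext => x; case: ifPn => x0; first by rewrite powR_inv1.
by rewrite powR_inv1 ?invrN ?opprK// oppr_ge0 ltW// ltNge.
Qed.

(** * Integration against a measure given by a density *)

Section density.
Context {d : measure_display} {T : measurableType d} {R : realType}.
Local Open Scope ereal_scope.

Import HBNNSimple.

(** By monotone convergence and linearity it suffices to treat indicators, where the claim is the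
    assumption on [nu]. Knowing [nu] only through its values on measurable sets is enough, so the
    lemma applies to [Pi] directly. *)
Lemma ge0_integral_density (mu nu : {measure set T -> \bar R}) (g : T -> R)
    (f : T -> \bar R) :
  measurable_fun [set: T] g -> (forall x, 0 <= g x)%R ->
  (forall A, measurable A -> nu A = \int[mu]_(x in A) (g x)%:E) ->
  measurable_fun [set: T] f -> (forall x, 0 <= f x) ->
  \int[nu]_x f x = \int[mu]_x (f x * (g x)%:E).
Proof.
move=> mg g0 nuE mf f0.
have mgE : measurable_fun [set: T] (EFin \o g) by exact/measurable_EFinP.
pose h := nnsfun_approx measurableT mf.
have hf x : (EFin \o h n) x @[n --> \oo] --> f x.
  by apply: cvg_nnsfun_approx.
have mh n : measurable_fun [set: T] (EFin \o h n).
  by apply/measurable_EFinP; exact/measurable_funP.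
have -> : \int[nu]_x f x = limn (fun n => \int[nu]_x (EFin \o h n) x).
  rewrite -monotone_convergence//.
  - by apply: eq_integral => x _; apply/esym/cvg_lim.
  - by move=> n x _ /=; rewrite lee_fin.
  - by move=> x _ a b ab; rewrite lee_fin; exact/lefP/nd_nnsfun_approx.
have -> : \int[mu]_x (f x * (g x)%:E) =
    limn (fun n => \int[mu]_x ((EFin \o h n) x * (g x)%:E)).
  rewrite -monotone_convergence//.
  - apply: eq_integral => x _; apply/esym/cvg_lim => //.
    by apply: cvgeZr.
  - by move=> n; exact: emeasurable_funM.
  - by move=> n x _ /=; rewrite mule_ge0// lee_fin.
  - move=> x _ a b ab /=; rewrite lee_wpmul2r ?lee_fin//.
    exact/lefP/nd_nnsfun_approx.
congr (limn _); apply/funext => n.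
(* The simple function is now split over its finitely many level sets. *)
transitivity (\int[nu]_x
   (\sum_(y \in range (h n)) (y * \1_(h n @^-1` [set y]) x)%:E)).
  by apply: eq_integral => t tE; rewrite /= fimfunE -fsumEFin.
have mi r : measurable_fun [set: T]
    (fun x => (r * \1_(h n @^-1` [set r]) x)%:E).
  by apply/measurable_EFinP; exact: measurable_funM.
rewrite ge0_integral_fsum//; last by move=> m y Ey; exact: nnfun_muleindic_ge0.
transitivity (\int[mu]_x (\sum_(y \in range (h n))
    (y * \1_(h n @^-1` [set y]) x)%:E * (g x)%:E)); last first.
  apply: eq_integral => x _.
  rewrite -ge0_mule_fsuml => [|y]; last exact: nnfun_muleindic_ge0.
  by rewrite /= [in RHS]fimfunE -fsumEFin.
rewrite ge0_integral_fsum//; last 2 first.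
  - by move=> y; exact: emeasurable_funM.
  - move=> r x _; apply: mule_ge0; last by rewrite lee_fin.
    exact: nnfun_muleindic_ge0.
apply: eq_fsbigr => r; rewrite inE => -[t _ <-{r}].
have mA : measurable (h n @^-1` [set h n t]) by [].
under eq_integral do rewrite EFinM.
rewrite ge0_integralZl ?lee_fin//; last first.
  by apply/measurable_EFinP.
rewrite integral_indic// setIT nuE//.
under [RHS]eq_integral do rewrite EFinM -muleA.
rewrite ge0_integralZl ?lee_fin//; last 2 first.
- by apply: emeasurable_funM => //; exact/measurable_EFinP.
- by move=> x _; rewrite mule_ge0 ?lee_fin.
congr (_ * _); rewrite integral_mkcond; apply: eq_integral => x _.
by rewrite /patch indicE; case: ifP => _; rewrite ?mul1e ?mul0e.
Qed.

Section mdensity.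
Context (mu : {measure set T -> \bar R}) (g : T -> R).

(** The two proofs are arguments so that the measure structure below can be inferred from the term
    itself. *)
Definition mdensity of measurable_fun [set: T] g & (forall x, (0 <= g x)%R) :=
  fun A : set T => \int[mu]_(x in A) (g x)%:E.

Context (mg : measurable_fun [set: T] g) (g0 : forall x, (0 <= g x)%R).

Let mdensity0 : mdensity mg g0 set0 = 0.
Proof. by rewrite /mdensity integral_set0. Qed.

Let mdensity_ge0 A : 0 <= mdensity mg g0 A.
Proof. by apply: integral_ge0 => x _; rewrite lee_fin. Qed.

Let mdensity_sigma_additive : semi_sigma_additive (mdensity mg g0).
Proof.
apply: semi_sigma_additive_nng_induced; first exact/measurable_EFinP.
by move=> x; rewrite lee_fin.
Qed.

HB.instance Definition _ := isMeasure.Build _ _ _ (mdensity mg g0)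
  mdensity0 mdensity_ge0 mdensity_sigma_additive.

Lemma ge0_integral_mdensity (f : T -> \bar R) :
  measurable_fun [set: T] f -> (forall x, 0 <= f x) ->
  \int[mdensity mg g0]_x f x = \int[mu]_x (f x * (g x)%:E).
Proof. exact: ge0_integral_density. Qed.

End mdensity.
End density.

(** * The Metropolis-Hastings independence kernel: stationarity and iterates *)

Section mhi.
Context {R : realType} {d : nat} (p q : 'rV[R]_d -> R).
Hypothesis mp : measurable_fun [set: 'rV[R]_d] p.
Hypothesis mq : measurable_fun [set: 'rV[R]_d] q.
Hypothesis p0 : forall x, 0 <= p x.
Hypothesis q0 : forall x, 0 <= q x.
Hypothesis q1 : (\int[lebesgue_rV d]_x (q x)%:E = 1)%E.
Local Notation leb := (lebesgue_rV d).
Local Notation mhi_density x y := (mhi_accept p q x y * q y).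

(** Multiplying the acceptance ratio by [q y] cancels the division by [q y], so the case [q y = 0]
    needs no separate branch: the minimum is then 0. Bounds, detailed balance and measurability are
    read off this form. *)
Lemma mhi_densityE x y : mhi_density x y =
  if 0 < p x then Num.min (p y * q x * (p x)^-1) (q y) else q y.
Proof.
rewrite /mhi_accept; have [px|px] := ltP 0 (p x); last first.
  have -> : p x = 0 by apply/eqP; rewrite eq_le px p0.
  by rewrite mul0r ltxx mul1r.
rewrite pmulr_rgt0//; have [qy|qy] := ltP 0 (q y).
  rewrite minr_pMl ?mul1r ?ltW//; congr (Num.min _ _).
  by rewrite invfM mulrA divfK// gt_eqF.
have -> : q y = 0 by apply/eqP; rewrite eq_le qy q0.
by rewrite mulr0; apply/esym/min_idPr; rewrite !mulr_ge0 ?invr_ge0.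
Qed.

Lemma mhi_density_ge0 x y : 0 <= mhi_density x y.
Proof.
rewrite mhi_densityE; case: ifP => // _.
by rewrite le_min q0 !mulr_ge0 ?invr_ge0.
Qed.

Lemma mhi_density_le x y : mhi_density x y <= q y.
Proof.
by rewrite mhi_densityE; case: ifP => // _; rewrite ge_min lexx orbT.
Qed.

Lemma mhi_detailed_balance x y :
  p x * mhi_density x y = p y * mhi_density y x.
Proof.
(* The right-hand side is symmetric in [a] and [b]. *)
suff H a b : p a * mhi_density a b = Num.min (p b * q a) (p a * q b).
  by rewrite !H minC.
rewrite mhi_densityE; have [pa|pa] := ltP 0 (p a).
  by rewrite minr_pMr ?ltW// mulrC divfK// gt_eqF.
have -> : p a = 0 by apply/eqP; rewrite eq_le pa p0.
by rewrite !mul0r; apply/esym/min_idPr; rewrite mulr_ge0.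
Qed.

Lemma measurable_mhi_density : measurable_fun [set: 'rV[R]_d * 'rV[R]_d]
  (fun z => mhi_density z.1 z.2).
Proof.
under eq_fun do rewrite mhi_densityE.
have mp1 : measurable_fun [set: 'rV[R]_d * 'rV[R]_d] (fun z => p z.1).
  exact: (measurableT_comp mp).
have mq2 : measurable_fun [set: 'rV[R]_d * 'rV[R]_d] (fun z => q z.2).
  exact: (measurableT_comp mq).
apply: measurable_fun_ifT => //; first exact: measurable_fun_ltr.
apply: measurable_minr => //; apply: measurable_funM.
  by apply: measurable_funM;
    [exact: (measurableT_comp mp)|exact: (measurableT_comp mq)].
exact: (measurableT_comp (measurable_inv R)).
Qed.

Lemma measurable_mhi_densityr x :
  measurable_fun [set: 'rV[R]_d] (fun y => mhi_density x y).
Proof. exact: (measurable_fun_pair2 x measurable_mhi_density). Qed.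

Local Open Scope ereal_scope.

(** The probability that a proposal made from [x] is accepted; the Dirac part of the kernel has
    weight [1 - mhi_moving x]. *)
Definition mhi_moving (x : 'rV[R]_d) : \bar R :=
  \int[leb]_y (mhi_density x y)%:E.

Lemma mhi_moving_ge0 x : 0 <= mhi_moving x.
Proof. by apply: integral_ge0 => y _; rewrite lee_fin mhi_density_ge0. Qed.

Lemma mhi_moving_le1 x : mhi_moving x <= 1.
Proof.
rewrite -q1; apply: ge0_le_integral => //.
- by move=> y _; rewrite lee_fin mhi_density_ge0.
- apply/measurable_EFinP; exact: measurable_mhi_densityr.
- exact/measurable_EFinP.
- by move=> y _; rewrite lee_fin mhi_density_le.
Qed.

Lemma mhi_moving_fin_num x : mhi_moving x \is a fin_num.
Proof.
rewrite ge0_fin_numE ?mhi_moving_ge0//.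
by rewrite (le_lt_trans (mhi_moving_le1 x)) ?ltry.
Qed.

Lemma mhi_staying_ge0 x : 0 <= 1 - mhi_moving x.
Proof. by rewrite sube_ge0 ?mhi_moving_le1// mhi_moving_fin_num. Qed.

Lemma measurable_mhi_moving : measurable_fun [set: 'rV[R]_d] mhi_moving.
Proof.
apply: (measurable_fun_fubini_tonelli_F (fun z => (mhi_density z.1 z.2)%:E)).
  apply/measurable_EFinP; exact: measurable_mhi_density.
by move=> z; rewrite lee_fin mhi_density_ge0.
Qed.

Lemma measurable_mhi_staying :
  measurable_fun [set: 'rV[R]_d] (fun x => 1 - mhi_moving x).
Proof. by apply: emeasurable_funB => //; exact: measurable_mhi_moving. Qed.

(** [mhi_kernel p q x] is a bare set function. Identifying it with a sum of two genuine measures,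
    one with a density and one a scaled Dirac mass, makes additivity of the integral in the measure
    available. *)
Lemma ge0_integral_mhi_kernel x (f : 'rV[R]_d -> \bar R) :
  measurable_fun [set: 'rV[R]_d] f -> (forall y, 0 <= f y) ->
  \int[mhi_kernel p q x]_y f y =
  \int[leb]_y (f y * (mhi_density x y)%:E) + (1 - mhi_moving x) * f x.
Proof.
move=> mf f0.
(* [mscale] takes a nonnegative real, so the finite weight of the Dirac part passes through
   [fine]. *)
have c0 : (0 <= fine (1 - mhi_moving x))%R by rewrite fine_ge0 ?mhi_staying_ge0.
have cE : (fine (1 - mhi_moving x))%:E = 1 - mhi_moving x.
  by rewrite fineK// fin_numB mhi_moving_fin_num.
have -> : mhi_kernel p q x = measure_add
    (mdensity leb _ (measurable_mhi_densityr x) (mhi_density_ge0 x))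
    (mscale (NngNum c0) \d_x) :> (set 'rV[R]_d -> \bar R).
  apply/funext => B; rewrite measure_addE /mhi_kernel/= /mscale/= cE.
  by rewrite muleC.
rewrite ge0_integral_measure_add// ge0_integral_mdensity//.
rewrite ge0_integral_mscale//= integral_dirac// diracT mul1e.
by rewrite -cE.
Qed.

Lemma measurable_integral_mhi_kernel (f : 'rV[R]_d -> \bar R) :
  measurable_fun [set: 'rV[R]_d] f -> (forall y, 0 <= f y) ->
  measurable_fun [set: 'rV[R]_d] (fun x => \int[mhi_kernel p q x]_y f y).
Proof.
move=> mf f0; under eq_fun do rewrite ge0_integral_mhi_kernel//.
apply: emeasurable_funD; last first.
  by apply: emeasurable_funM => //; exact: measurable_mhi_staying.
apply: (measurable_fun_fubini_tonelli_F
  (fun z => f z.2 * (mhi_density z.1 z.2)%:E)).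
  apply: emeasurable_funM; first exact: (measurableT_comp mf).
  apply/measurable_EFinP; exact: measurable_mhi_density.
by move=> z; rewrite mule_ge0// lee_fin mhi_density_ge0.
Qed.

Lemma integral_mhi_kernel_ge0 x (f : 'rV[R]_d -> \bar R) :
  measurable_fun [set: 'rV[R]_d] f -> (forall y, 0 <= f y) ->
  0 <= \int[mhi_kernel p q x]_y f y.
Proof.
move=> mf f0; rewrite ge0_integral_mhi_kernel// adde_ge0//.
  by apply: integral_ge0 => y _; rewrite mule_ge0// lee_fin mhi_density_ge0.
by rewrite mule_ge0 ?mhi_staying_ge0.
Qed.

(** Tonelli and detailed balance turn the accepted part into the integral of [mhi_moving * f * p];
    adding the rejected part restores total weight 1, since [mhi_moving] is finite. *)
Lemma mhi_stationary (Pi : {measure set 'rV[R]_d -> \bar R})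
    (f : 'rV[R]_d -> \bar R) :
  (forall A, measurable A -> Pi A = \int[leb]_(x in A) (p x)%:E) ->
  measurable_fun [set: 'rV[R]_d] f -> (forall y, 0 <= f y) ->
  \int[Pi]_x \int[mhi_kernel p q x]_y f y = \int[Pi]_x f x.
Proof.
move=> PiE mf f0.
have pE x : 0 <= (p x)%:E by rewrite lee_fin.
have aE x y : 0 <= (mhi_density x y)%:E by rewrite lee_fin mhi_density_ge0.
have mpE : measurable_fun [set: 'rV[R]_d] (EFin \o p) by exact/measurable_EFinP.
have maE : measurable_fun [set: 'rV[R]_d * 'rV[R]_d]
    (fun z => (mhi_density z.1 z.2)%:E).
  apply/measurable_EFinP; exact: measurable_mhi_density.
have maEr x : measurable_fun [set: 'rV[R]_d] (fun y => (mhi_density x y)%:E).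
  apply/measurable_EFinP; exact: measurable_mhi_densityr.
(* The integrand of the accepted part, jointly in the current and the next state. *)
pose F z := f z.2 * (mhi_density z.1 z.2)%:E * (p z.1)%:E.
have mF : measurable_fun [set: 'rV[R]_d * 'rV[R]_d] F.
  apply: emeasurable_funM; last exact: (measurableT_comp mpE).
  by apply: emeasurable_funM => //; exact: (measurableT_comp mf).
have F0 z : 0 <= F z by rewrite /F !mule_ge0.
have mstay : measurable_fun [set: 'rV[R]_d]
    (fun x => (1 - mhi_moving x) * f x * (p x)%:E).
  by apply: emeasurable_funM => //; apply: emeasurable_funM => //;
    exact: measurable_mhi_staying.
have mmove : measurable_fun [set: 'rV[R]_d]
    (fun x => mhi_moving x * f x * (p x)%:E).
  by apply: emeasurable_funM => //; apply: emeasurable_funM => //;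
    exact: measurable_mhi_moving.
rewrite !(ge0_integral_density leb Pi p)//; last 2 first.
- exact: measurable_integral_mhi_kernel.
- by move=> x; exact: integral_mhi_kernel_ge0.
transitivity (\int[leb]_x (\int[leb]_y F (x, y) +
    (1 - mhi_moving x) * f x * (p x)%:E)).
  apply: eq_integral => x _; rewrite ge0_integral_mhi_kernel// ge0_muleDl//.
  - rewrite -ge0_integralZr//.
    + by apply: emeasurable_funM => //; exact: maEr.
    + by move=> y _; rewrite mule_ge0.
  - by apply: integral_ge0 => y _; rewrite mule_ge0.
  - by rewrite mule_ge0 ?mhi_staying_ge0.
rewrite ge0_integralD//; last 3 first.
- by move=> x _; apply: integral_ge0.
- exact: (measurable_fun_fubini_tonelli_F F).
- by move=> x _; rewrite !mule_ge0 ?mhi_staying_ge0.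
(* The inner integral now runs over the current state [x]. Detailed balance replaces [p x] times the
   density from [x] to [y] by [p y] times the density from [y] to [x], which integrates over [x] to
   [mhi_moving y]. *)
rewrite (fubini_tonelli F)//.
transitivity (\int[leb]_y (mhi_moving y * f y * (p y)%:E) +
    \int[leb]_x ((1 - mhi_moving x) * f x * (p x)%:E)).
  congr (_ + _); apply: eq_integral => y _.
  rewrite -muleA /mhi_moving -ge0_integralZr//; last by rewrite mule_ge0.
  apply: eq_integral => x _; rewrite /F/= -muleA [RHS]muleCA; congr (_ * _).
  by rewrite muleC [RHS]muleC -!EFinM mhi_detailed_balance.
rewrite -ge0_integralD//; last 2 first.
- by move=> x _; rewrite !mule_ge0 ?mhi_moving_ge0.
- by move=> x _; rewrite !mule_ge0 ?mhi_staying_ge0.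
apply: eq_integral => x _.
rewrite -!muleA -ge0_muleDl ?mhi_moving_ge0//; last first.
  exact: mhi_staying_ge0.
by rewrite addeC subeK ?mhi_moving_fin_num// mul1e.
Qed.

(** [kernel_iter] treats one step as a separate case, so the recursion must be checked at [t = 0],
    where integrating the Dirac mass at [B] gives the kernel back. *)
Lemma mhi_kernel_iterS t x (B : set 'rV[R]_d) : measurable B ->
  kernel_iter (mhi_kernel p q) t.+1 x B =
  \int[mhi_kernel p q x]_y kernel_iter (mhi_kernel p q) t y B.
Proof.
move=> mB; case: t => [|t//] /=; rewrite ge0_integral_mhi_kernel//; last first.
  exact: measurable_fun_dirac.
rewrite /mhi_kernel (muleC (\d_x B)); congr (_ + _).
rewrite integral_mkcond; apply: eq_integral => y _.
by rewrite /patch diracE; case: ifP => _; rewrite ?mul1e ?mul0e.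
Qed.

(** The two properties are proved together because each induction step uses both. *)
Lemma mhi_kernel_iter_ge0_measurable t (B : set 'rV[R]_d) : measurable B ->
  (forall x, 0 <= kernel_iter (mhi_kernel p q) t x B) /\
  measurable_fun [set: 'rV[R]_d]
    (fun x => kernel_iter (mhi_kernel p q) t x B).
Proof.
move=> mB; elim: t => [|t [t0 mt]].
  by split => [x|]; [rewrite /= diracE lee_fin|exact: measurable_fun_dirac].
split=> [x|]; first by rewrite mhi_kernel_iterS// integral_mhi_kernel_ge0.
under eq_fun do rewrite mhi_kernel_iterS//.
exact: measurable_integral_mhi_kernel.
Qed.

Context (Pi : probability 'rV[R]_d R).
Hypothesis PiE :
  forall A, measurable A -> Pi A = \int[leb]_(x in A) (p x)%:E.

Lemma integral_mhi_kernel_iter t (B : set 'rV[R]_d) : measurable B ->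
  \int[Pi]_x kernel_iter (mhi_kernel p q) t x B = Pi B.
Proof.
move=> mB; elim: t => [|t IH].
  by rewrite -[in RHS](setIT B) -integral_indic.
have [t0 mt] := mhi_kernel_iter_ge0_measurable t B mB.
under eq_integral do rewrite mhi_kernel_iterS//.
by rewrite mhi_stationary.
Qed.

(** The first step from [z] draws from [Pi] with probability [e] and stays at [z] otherwise. A draw
    from [Pi] keeps that law by stationarity; staying gives the induction hypothesis with the factor
    [1 - e]. *)
Lemma mhi_kernel_iter_min (z : 'rV[R]_d) t (B : set 'rV[R]_d) :
  (0 < p z)%R -> (forall y, q z / p z * p y <= q y)%R -> measurable B ->
  kernel_iter (mhi_kernel p q) t z B =
  ((1 - q z / p z) ^+ t)%:E * \d_z B + (1 - (1 - q z / p z) ^+ t)%:E * Pi B.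
Proof.
move=> pz zmin mB; set e := (q z / p z)%R.
have e0 : (0 <= e)%R by rewrite divr_ge0// ltW.
have aE y : (mhi_accept p q z y * q y = e * p y)%R.
  (* The assumption on [z] says that the first argument of the minimum is always the smaller one. *)
  rewrite mhi_densityE// pz -mulrA mulrC; apply/min_idPl.
  exact: zmin.
have mE : mhi_moving z = e%:E.
  rewrite /mhi_moving; under eq_integral do rewrite aE EFinM.
  rewrite ge0_integralZl//; last 2 first.
  - exact/measurable_EFinP.
  - by move=> y _; rewrite lee_fin.
  by rewrite -PiE// probability_setT mule1.
elim: t => [|t IH].
  by rewrite expr0 subrr mul0e adde0 mul1e.
have [t0 mt] := mhi_kernel_iter_ge0_measurable t B mB.
rewrite mhi_kernel_iterS// ge0_integral_mhi_kernel// mE IH.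
under eq_integral do rewrite aE EFinM muleCA.
rewrite ge0_integralZl//; last 2 first.
- by apply: emeasurable_funM => //; exact/measurable_EFinP.
- by move=> y _; rewrite mule_ge0// lee_fin.
rewrite -(ge0_integral_density leb Pi p)// integral_mhi_kernel_iter//.
(* Both measures of [B] are finite, so the remaining identity is one between reals. *)
have /fineK <- : Pi B \is a fin_num by exact: fin_num_measure.
have /fineK <- : (\d_z B : \bar R) \is a fin_num by exact: fin_num_measure.
rewrite -EFinB -!(EFinM, EFinD); congr (_%:E).
by rewrite exprS; ring.
Qed.

End mhi.

(** * Mixtures and images of probability measures *)

Section mixture.
Context {disp : measure_display} {T : measurableType disp} {R : realType}.
Local Open Scope ereal_scope.

(** Serves twice: on [T * T] to build the coupling of the upper bound, and on [T] to realise the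
    first marginal as a measure in the lower bound. *)
Lemma probability_mixture (c : R) (mu nu : probability T R) :
  (0 <= c <= 1)%R -> exists xi : probability T R,
    (forall A, xi A = c%:E * mu A + (1 - c)%:E * nu A) /\
    forall f, measurable_fun [set: T] f -> (forall x, 0 <= f x) ->
      \int[xi]_x f x = c%:E * \int[mu]_x f x + (1 - c)%:E * \int[nu]_x f x.
Proof.
move=> /andP[c0 c1]; have c1' : (0 <= 1 - c)%R by rewrite subr_ge0.
pose m : {measure set T -> \bar R} :=
  measure_add (mscale (NngNum c0) mu) (mscale (NngNum c1') nu).
have mE A : m A = c%:E * mu A + (1 - c)%:E * nu A.
  exact: measure_addE.
have mT : m [set: T] = 1.
  by rewrite mE !probability_setT !mule1 -EFinD addrC subrK.
pose H := Measure_isProbability.Build _ _ _ m mT.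
pose xi : probability T R := HB.pack (Measure.sort m) H.
exists xi; split => // f mf f0; rewrite /xi/=.
by rewrite ge0_integral_measure_add// !ge0_integral_mscale.
Qed.

End mixture.

(** Change of variables with the image measure known only setwise, which is how [coupling] describes
    marginals. *)
Lemma ge0_integral_comp_image {d d'} {T : measurableType d}
    {U : measurableType d'} {R : realType} (mu : probability T R)
    (nu : {measure set U -> \bar R}) (h : T -> U) (f : U -> \bar R) :
  measurable_fun [set: T] h ->
  (forall A, measurable A -> mu (h @^-1` A) = nu A) ->
  measurable_fun [set: U] f -> (forall x, 0 <= f x)%E ->
  (\int[mu]_x f (h x) = \int[nu]_x f x)%E.
Proof.
move=> mh munu mf f0.
pose H := isMeasurableFun.Build _ _ _ _ _ mh.
pose X : {RV mu >-> U} := HB.pack h H.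
rewrite -(ge0_integral_distribution X)//; apply: eq_measure_integral => A mA _.
by rewrite -munu.
Qed.

(** * Wasserstein distance between [Pi] and its mixture with a Dirac mass *)

Section wasserstein_dirac.
Context {disp : measure_display} {T : measurableType disp} {R : realType}.
Local Open Scope ereal_scope.

Variables (rho : T -> T -> R) (a : T) (c : R) (Pi : probability T R).
Hypothesis rho_metric : is_metric rho.
Hypothesis mrho : measurable_fun [set: T * T] (fun z => rho z.1 z.2).
Hypothesis c01 : (0 <= c <= 1)%R.
(** A bare set function, because the iterated kernel to be substituted for it carries no measure
    structure. *)
Variable mu : set T -> \bar R.
Hypothesis muE : forall A, measurable A ->
  mu A = c%:E * \d_a A + (1 - c)%:E * Pi A.

Let mrhoa : measurable_fun [set: T] (rho ^~ a).
Proof. exact: (measurable_fun_pair1 a mrho). Qed.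

Let mrhoE : measurable_fun [set: T * T] (fun z => (rho z.1 z.2)%:E).
Proof. exact/measurable_EFinP. Qed.

Let c0 : (0 <= c)%R. Proof. by case/andP: c01. Qed.

Lemma wasserstein_dirac_mixture_le :
  wasserstein rho mu Pi <= c%:E * \int[Pi]_x (rho x a)%:E.
Proof.
have ma : measurable_fun [set: T] (fun x : T => (a, x)).
  exact: measurable_fun_pair.
have md : measurable_fun [set: T] (fun x : T => (x, x)).
  exact: measurable_fun_pair.
(* Under [Pi], the law of [(a, x)] is the product of [\d_a] and [Pi], and the law of [(x, x)] is the
   diagonal coupling. They get weights [c] and [1 - c]. *)
pose H1 := isMeasurableFun.Build _ _ _ _ _ ma.
pose X1 : {RV Pi >-> (T * T)%type} := HB.pack (fun x : T => (a, x)) H1.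
pose H2 := isMeasurableFun.Build _ _ _ _ _ md.
pose X2 : {RV Pi >-> (T * T)%type} := HB.pack (fun x : T => (x, x)) H2.
have [xi [xiE xii]] := probability_mixture c (distribution Pi X1)
  (distribution Pi X2) c01.
apply: ge_ereal_inf; exists (\int[xi]_z (rho z.1 z.2)%:E).
  exists xi => // A mA; rewrite !xiE /distribution /pushforward.
  split.
    rewrite muE// diracE; congr (_ + _); last first.
      by congr (_ * Pi _); apply/seteqP; split => x; [case|].
    (* The first coordinate of [X1] is constantly [a], so the preimage is everything or empty. *)
    congr (_ * _); case: (boolP (a \in A)) => [/set_mem Aa|/=/negP Aa].
      rewrite -[RHS](probability_setT Pi); congr (Pi _).
      by apply/seteqP; split => x.
    rewrite -[RHS](measure0 Pi); congr (Pi _).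
    by apply/seteqP; split => x // [/mem_set].
  transitivity (c%:E * Pi A + (1 - c)%:E * Pi A).
    by congr (_ * Pi _ + _ * Pi _); apply/seteqP; split => x //; case.
  rewrite -ge0_muleDl ?lee_fin ?subr_ge0//; last by case/andP: c01.
  by rewrite -EFinD subrKC mul1e.
have rho0 (z : T * T) : 0 <= (rho z.1 z.2)%:E.
  by rewrite lee_fin; exact: (is_metric_ge0 rho_metric).
rewrite xii// !ge0_integral_distribution//=.
(* The diagonal part costs nothing. *)
under [X in _ + _ * X]eq_integral.
  move=> x _ /=.
  rewrite (_ : rho x x = 0%R); last exact/(is_metric_eq0 rho_metric).
  over.
rewrite integral0 mule0 adde0 le_eqVlt; apply/orP; left; apply/eqP.
congr (_ * _); apply: eq_integral => x _ /=.
by rewrite (is_metric_sym rho_metric).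
Qed.

Lemma wasserstein_dirac_mixture_ge :
  c%:E * \int[Pi]_x (rho x a)%:E <= wasserstein rho mu Pi.
Proof.
apply/ereal_infP => _ [xi cxi <-].
have rhoaa : rho a a = 0%R by exact/(is_metric_eq0 rho_metric).
(* The bound by [n] makes the integrals of [h n] finite, as the subtraction at the end of [key]
   requires. *)
pose h n x := Num.min (rho x a) n%:R.
have h0 n x : (0 <= h n x)%R by rewrite le_min (is_metric_ge0 rho_metric) ler0n.
have hE0 n x : 0 <= (h n x)%:E by rewrite lee_fin.
have rhoE0 (z : T * T) : 0 <= (rho z.1 z.2)%:E.
  by rewrite lee_fin (is_metric_ge0 rho_metric).
have mh n : measurable_fun [set: T] (fun x => (h n x)%:E).
  by apply/measurable_EFinP; exact: measurable_minr.
have hlip n (x y : T) : (h n y <= rho x y + h n x)%R.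
  have := is_metric_triangle rho_metric y x a.
  have := is_metric_ge0 rho_metric x y.
  rewrite (is_metric_sym rho_metric y x) /h !minElt.
  by do 2 case: ifPn => //; rewrite ?ltNge ?negbK; lra.
(* [nu] is a genuine measure agreeing with [mu] on measurable sets, so that one can integrate
   against the first marginal. *)
have [nu [nuE nui]] := probability_mixture c \d_a Pi c01.
have key n : c%:E * \int[Pi]_x (h n x)%:E <= \int[xi]_z (rho z.1 z.2)%:E.
  have hfin : \int[Pi]_x (h n x)%:E \is a fin_num.
    rewrite ge0_fin_numE; last by apply: integral_ge0 => x _; rewrite lee_fin.
    apply: (@le_lt_trans _ _ (\int[Pi]_x (n%:R)%:E)); last first.
      rewrite integral_cst// lte_mul_pinfty// ?lee_fin//.
      exact: (le_lt_trans (probability_le1 Pi measurableT) (ltry 1)).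
    apply: ge0_le_integral => //.
    - by move=> x _; rewrite lee_fin ge_min lexx orbT.
  have e2 : \int[xi]_z (h n z.2)%:E = \int[Pi]_x (h n x)%:E.
    apply: (ge0_integral_comp_image _ _ snd (fun x => (h n x)%:E)) => //.
    - move=> A mA; apply: etrans (cxi A mA).2; congr (xi _).
      by apply/seteqP; split => z //= [].
  have e1 : \int[xi]_z (h n z.1)%:E = (1 - c)%:E * \int[Pi]_x (h n x)%:E.
    rewrite (ge0_integral_comp_image _ nu fst (fun x => (h n x)%:E))//.
    (* The test function vanishes at [a], so only the [Pi] part of the first marginal
       contributes. *)
    - have hda : \int[\d_a]_x (h n x)%:E = 0.
        rewrite integral_dirac// diracT mul1e /h rhoaa.
        by rewrite (min_idPl _).
      rewrite nui// -[RHS]add0e; congr (_ + _).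
      by apply: etrans (mule0 c%:E); congr (_ * _); exact: hda.
    - move=> A mA; transitivity (mu A); last by rewrite muE//; exact/esym/nuE.
      apply: etrans (cxi A mA).1; congr (xi _).
      by apply/seteqP; split => z //= [].
  (* Integrating the Lipschitz bound against [xi] compares the two marginal integrals; their
     difference has coefficient [1 - (1 - c) = c]. *)
  have : \int[xi]_z (h n z.2)%:E <=
      \int[xi]_z ((rho z.1 z.2)%:E + (h n z.1)%:E).
    apply: ge0_le_integral => //.
    - exact: (measurableT_comp (mh n)).
    - by apply: emeasurable_funD => //; exact: (measurableT_comp (mh n)).
    - by move=> z _; rewrite -EFinD lee_fin.
  rewrite ge0_integralD//; last exact: (measurableT_comp (mh n)).
  rewrite e1 e2 -leeBlDr ?fin_numM//.
  rewrite -[X in X - _]mul1e -muleBl ?fin_num_adde_defr//.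
  by rewrite -EFinB opprB addrC subrK.
have cvgh : \int[Pi]_x (h n x)%:E @[n --> \oo] --> \int[Pi]_x (rho x a)%:E.
  rewrite (_ : \int[Pi]_x (rho x a)%:E =
      \int[Pi]_x limn (fun n => (h n x)%:E)).
    apply: cvg_monotone_convergence => //.
    - move=> x _ m n mn; rewrite lee_fin /h le_min ge_min lexx/=.
      by rewrite ge_min ler_nat mn orbT.
  (* For fixed [x] the truncation is inactive once [n] exceeds [rho x a]. *)
  apply: eq_integral => x _; apply/esym/cvg_lim => //; apply: cvg_near_cst.
  near=> n; rewrite /h; congr (_%:E); apply/min_idPl.
  by near: n; exact: nbhs_infty_ger.
have cvgch : c%:E * \int[Pi]_x (h n x)%:E @[n --> \oo] -->
    c%:E * \int[Pi]_x (rho x a)%:E by exact: cvgeZl.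
rewrite -(cvg_lim _ cvgch)//; apply: lime_le; last exact: nearW.
by apply/cvg_ex; eexists; exact: cvgch.
Unshelve. all: by end_near. Qed.

Lemma wasserstein_dirac_mixture :
  wasserstein rho mu Pi = c%:E * \int[Pi]_x (rho x a)%:E.
Proof.
apply/eqP; rewrite eq_le wasserstein_dirac_mixture_le.
exact: wasserstein_dirac_mixture_ge.
Qed.

End wasserstein_dirac.

(** * Borel measurability of a lower semicontinuous metric *)

Lemma rat_ball_sub_open {R : realType} {d : nat} (x : 'rV[R]_d)
    (A : set 'rV[R]_d) :
  open A -> A x -> exists2 k, rat_ball k x & rat_ball k `<=` A.
Proof.
move=> /open_rV_bigcup {1}-> [k _].
by case: ifPn => // /asboolP kA kx; exists k.
Qed.

(** Pairs carry the product sigma-algebra, not one generated by open sets of pairs. By second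
    countability an open set is a countable union of products of rational balls. *)
Lemma open_measurable_rV2 (R : realType) (d : nat)
    (U : set ('rV[R]_d * 'rV[R]_d)) : open U -> measurable U.
Proof.
move=> oU.
pose B (k : ('rV[rat]_d * nat) * ('rV[rat]_d * nat)) :
  set ('rV[R]_d * 'rV[R]_d) := rat_ball k.1 `*` rat_ball k.2.
rewrite (_ : U = \bigcup_k (if `[< B k `<=` U >] then B k else set0)).
  apply: countable_bigcupT_measurable; first exact: countableP.
  move=> k; case: ifPn => // _.
  by apply: measurableX; apply: open_measurable_rV; exact: ball_open.
apply/seteqP; split=> [[x y] Uxy|z [k _]]; last first.
  by case: ifPn => // /asboolP; exact.
have /nbhs_ballP[e /= e0 eU] : nbhs (x, y) U by exact: open_nbhs_nbhs.
have [k1 k1x k1e] := rat_ball_sub_open x _ (ball_open x e) (ballxx x e0).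
have [k2 k2y k2e] := rat_ball_sub_open y _ (ball_open y e) (ballxx y e0).
exists (k1, k2) => //; rewrite asboolT//.
by move=> [u v] [/= /k1e ? /k2e ?]; apply: eU.
Qed.

(** Lower semicontinuity makes the strict superlevel sets open, and the rays above real numbers
    generate the sigma-algebra of the extended reals. *)
Lemma lower_semicontinuous_measurable_rV2 (R : realType) (d : nat)
    (f : 'rV[R]_d * 'rV[R]_d -> R) :
  lower_semicontinuous (EFin \o f) ->
  measurable_fun [set: 'rV[R]_d * 'rV[R]_d] f.
Proof.
move=> /lower_semicontinuousP scf; apply/measurable_EFinP.
apply: (measurability _ (ErealGenOInfty.measurableE R)).
move=> /= _ [_ [a ->]] <-; apply: measurableI => //.
by apply: open_measurable_rV2; rewrite preimage_itvoy; exact: scf.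
Qed.

Theorem proposition1 (R : realType) (d : nat) (Theta : set 'rV[R]_d)
  (Pi Q : probability 'rV[R]_d R) (p q : 'rV[R]_d -> R)
  (rho : 'rV[R]_d -> 'rV[R]_d -> R) (thetas : 'rV[R]_d) (t : nat)
  (Theta_nonempty : Theta !=set0) (Theta_measurable : measurable Theta)
  (Pi_density : has_density_on Pi p Theta)
  (Q_density : has_density_on Q q Theta)
  (Q_neq_Pi : ~ (forall A, measurable A -> Q A = Pi A))
  (rho_metric : is_metric rho)
  (rho_lsc : lower_semicontinuous
     (fun z : 'rV[R]_d * 'rV[R]_d => (rho z.1 z.2)%:E))
  (thetas_in : Theta thetas)
  (thetas_min : forall theta, Theta theta ->
     q thetas / p thetas <= q theta / p theta)
  (t_ge1 : (1 <= t)%N) :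
  wasserstein rho (kernel_iter (mhi_kernel p q) t thetas) Pi =
  (((1 - q thetas / p thetas) ^+ t)%:E *
   \int[Pi]_theta (rho theta thetas)%:E)%E.
Proof.
have [mp PiE p_gt0 p_eq0] := Pi_density.
have [mq QE q_gt0 q_eq0] := Q_density.
have p0 x : 0 <= p x.
  by have [/p_gt0/ltW//|/p_eq0 ->] := pselect (Theta x).
have q0 x : 0 <= q x.
  by have [/q_gt0/ltW//|/q_eq0 ->] := pselect (Theta x).
have q1 : (\int[lebesgue_rV d]_x (q x)%:E = 1)%E.
  by rewrite -QE// probability_setT.
have e0 : 0 <= q thetas / p thetas by rewrite divr_ge0.
(* The minimum over [Theta] becomes an inequality on the whole space because [p] vanishes outside
   [Theta]. *)
have qmin y : q thetas / p thetas * p y <= q y.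
  have [Ty|nTy] := pselect (Theta y); last by rewrite (p_eq0 y)// mulr0.
  by rewrite -ler_pdivlMr ?p_gt0// thetas_min.
(* Obtained by integrating [qmin], both densities having total mass 1; it puts the weight
   [(1 - e) ^+ t] in the unit interval. *)
have e1 : q thetas / p thetas <= 1.
  rewrite -lee_fin -q1 -[leLHS]mule1 -(probability_setT Pi) PiE//.
  rewrite -ge0_integralZl//.
  - apply: ge0_le_integral => //.
    + by move=> x _; rewrite -EFinM lee_fin mulr_ge0.
    + by apply: emeasurable_funM => //; exact/measurable_EFinP.
    + exact/measurable_EFinP.
    + by move=> x _; rewrite -EFinM lee_fin.
  - exact/measurable_EFinP.
  - by move=> x _; rewrite lee_fin.
apply: wasserstein_dirac_mixture => //.
- exact: lower_semicontinuous_measurable_rV2.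
- by rewrite exprn_ge0 ?exprn_ile1// ?subr_ge0// gerBl.
- by move=> A mA; rewrite (mhi_kernel_iter_min _ _ mp mq p0 q0 q1 Pi)// p_gt0.
Qed.
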